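(* Let $\mathbb{X}$ be a complex Banach space and let $T\in \mathbb{L}(\mathbb{X}, \mathbb{X}^* )$. Suppose that $x \in \mathbb{X}$. Then $\perp_T$ is left symmetric at $x$ if and only if there exists $\phi_0 \in [0, 2\pi)$ such that for every $\theta \in [0,2\pi)$ and every $y \in \mathbb{X}$: \[ y \in x_{T_\theta}^+ \implies x \in y_{T_{\theta - \phi_0}}^+ \quad\text{and}\quad y \in x_{T_\theta}^- \implies x \in y_{T_{\theta -\phi_0}}^-.\]
   Context: $\mathbb{X}^*$ is the dual space of $\mathbb{X}$ and $\mathbb{L}(\mathbb{X},\mathbb{X}^* )$ is the set of all bounded linear operators from $\mathbb{X}$ to $\mathbb{X}^*$. Write $(Tx,y) = Tx(y)$. For $x,y\in\mathbb{X}$, $x \perp_T y$ means $(Tx,y)=0$. The relation $\perp_T$ is left symmetric at $x$ if for each $y\in\mathbb{X}$, $x\perp_T y$ implies $y\perp_T x$. For an angle $\theta$ (any real number, equivalently taken modulo $2\pi$), put $(T_\theta x,y) = \cos\theta\,\Re (Tx,y) + \sin\theta\,\Im (Tx,y)$. Write $y\in x_{T_\theta}^+$ if $(T_\theta x,y)\ge 0$ and $y\in x_{T_\theta}^-$ if $(T_\theta x,y)\le 0$. *)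

(* Defs.v *)
From HB Require Import structures.
From mathcomp Require Import all_boot all_order all_algebra.
From mathcomp Require Import all_classical all_reals all_analysis.
From mathcomp Require Import complex.

Set Implicit Arguments.
Unset Strict Implicit.
Unset Printing Implicit Defensive.

Import Order.TTheory GRing.Theory Num.Theory.
Import numFieldNormedType.Exports.

Local Open Scope classical_set_scope.
Local Open Scope complex_scope.
Local Open Scope ring_scope.

(* Norms of a [normedModType K] take values in [K]; for [K = R[i]] they are
   nonnegative, hence real, complex numbers, and so is a bound [M] below as
   soon as [V] is nontrivial. *)
Definition bounded_op (K : numFieldType) (V W : normedModType K) (f : V -> W) :=
  exists M : K, forall x, `|f x| <= M * `|x|.

Lemma bounded_opP (K : numFieldType) (V W : normedModType K)
  (f : {linear V -> W}) : bounded_op f <-> continuous f.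
Proof.
split=> [[M fM]|].
  apply: bounded_linear_continuous; apply/linear_boundedP.
  have [[x x0]|/forallNP V0] := pselect (exists x : V, x != 0).
    have xgt0 : 0 < `|x| by rewrite normr_gt0.
    have M0 : 0 <= M.
      by rewrite -(pmulr_lge0 _ xgt0); apply: le_trans (fM x).
    near=> r => y; apply: (le_trans (fM y)); apply: ler_wpM2r => //.
    by near: r; apply: nbhs_pinfty_ge; apply: ger0_real.
  near=> r => y; have /negP/negPn/eqP -> := V0 y.
  by rewrite linear0 !normr0 mulr0.
move=> /linear_bounded_continuous/linear_boundedP/pinfty_ex_gt0[M _ fM].
by exists M.
Unshelve. all: by end_near. Qed.

Section Dual.
Context {R : realType} (X : normedModType R[i]).

Definition dual_pred : {pred X -> (R[i])^o} :=
  mem [set f : X -> (R[i])^o | linear f /\ bounded_op f].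

Lemma dual_predP (f : X -> (R[i])^o) :
  reflect (linear f /\ bounded_op f) (f \in dual_pred).
Proof.
by apply: (iffP idP); rewrite inE.
Qed.

Record dual_space := Dual {
  dual_fun :> X -> (R[i])^o;
  dual_funP : dual_fun \in dual_pred }.

HB.instance Definition _ := [isSub for dual_fun].
HB.instance Definition _ := [Choice of dual_space by <:].

Lemma dual_linear (f : dual_space) : linear f.
Proof. by have /dual_predP[] := dual_funP f. Qed.

Lemma dual_bounded (f : dual_space) : bounded_op f.
Proof. by have /dual_predP[] := dual_funP f. Qed.

HB.instance Definition _ (f : dual_space) :=
  GRing.isLinear.Build R[i] X (R[i])^o _ (dual_fun f) (dual_linear f).

Lemma dual_submod_closed : submod_closed dual_pred.
Proof.
split=> [|a f g /dual_predP[lf [M fM]] /dual_predP[lg [N gN]]].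
  apply/dual_predP; split=> [a x y|]; first by rewrite /= scaler0 addr0.
  by exists 0 => x; rewrite mul0r normr0.
apply/dual_predP; split=> [b x y|].
  rewrite !fctE lf lg !scalerDr !scalerA (mulrC a) -!addrA; congr (_ + _).
  by rewrite addrCA.
exists (`|a| * M + N) => x; rewrite !fctE (le_trans (ler_normD _ _))//.
by rewrite mulrDl lerD// normrZ -mulrA ler_wpM2l.
Qed.

HB.instance Definition _ :=
  GRing.isSubmodClosed.Build R[i] _ dual_pred dual_submod_closed.
HB.instance Definition _ :=
  [SubChoice_isSubLmodule of dual_space by <:].

Let dual_values (f : dual_space) : set R :=
  [set complex.Re `|f x| | x in [set x : X | `|x| <= 1]].

(* The usual operator norm, injected from [R] into [R[i]]. *)
Definition dual_norm (f : dual_space) : R[i] := (sup (dual_values f))%:C.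

Let normE (z : R[i]) : `|z| = (complex.Re `|z|)%:C.
Proof. by case: z. Qed.

Let normRe (V : normedModType R[i]) (v : V) : `|v| = (complex.Re `|v|)%:C.
Proof.
have := normr_ge0 v; case: (`|v|) => a b; rewrite lecE /= => /andP[/eqP -> _].
by [].
Qed.

Let dual_has_sup (f : dual_space) : has_sup (dual_values f).
Proof.
split; first by exists (complex.Re `|f 0|), 0 => //=; rewrite normr0 ler01.
have [M fM] := dual_bounded f.
have [M' fM'] : exists M' : R, forall x, `|x| <= 1 -> `|f x| <= M'%:C.
  exists (complex.Re `|M|) => x x1; rewrite -normE.
  apply: le_trans (fM x) _.
  have Mx0 : 0 <= M * `|x| by apply: le_trans (fM x).
  by rewrite -(ger0_norm Mx0) normrM normr_id ler_piMr.
exists M' => _ [x /= x1 <-]; move: (fM' x x1).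
by rewrite [`|f x|]normRe lecR.
Qed.

Lemma dual_normP (f : dual_space) (x : X) : `|f x| <= dual_norm f * `|x|.
Proof.
have [->|x0] := eqVneq x 0; first by rewrite linear0 !normr0 mulr0.
have xgt0 : 0 < `|x| by rewrite normr_gt0.
rewrite -ler_pdivrMr// mulrC -[X in X * _]ger0_norm ?invr_ge0//.
rewrite -normrZ -linearZ; set y := _ *: x.
rewrite [`|f y|]normRe lecR; apply: ub_le_sup.
  by case: (dual_has_sup f).
exists y => //=.
by rewrite normrZ ger0_norm ?invr_ge0// mulVf ?normr_eq0.
Qed.

Lemma dual_norm_le (f : dual_space) (M : R[i]) : 0 <= M ->
  (forall x, `|f x| <= M * `|x|) -> dual_norm f <= M.
Proof.
move=> M0 fM; have ME : M = (complex.Re M)%:C.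
  by rewrite -(ger0_norm M0) -normE.
rewrite ME lecR; apply: ge_sup; first by case: (dual_has_sup f).
move=> _ [x x1 <-]; rewrite -lecR -normRe -ME (le_trans (fM x))//.
by rewrite ler_piMr.
Qed.

Lemma dual_norm_ge0 (f : dual_space) : 0 <= dual_norm f.
Proof.
rewrite ler0c; apply: le_trans (_ : complex.Re `|f 0| <= _).
  by rewrite linear0 normr0.
apply: ub_le_sup; first by case: (dual_has_sup f).
by exists 0 => //=; rewrite normr0 ler01.
Qed.

Let dual_normD (f g : dual_space) :
  dual_norm (f + g) <= dual_norm f + dual_norm g.
Proof.
apply: dual_norm_le => [|x]; first by rewrite addr_ge0 ?dual_norm_ge0.
rewrite (_ : (f + g) x = f x + g x)// (le_trans (ler_normD _ _))//.
by rewrite mulrDl lerD// dual_normP.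
Qed.

Let dual_normZle (a : R[i]) (f : dual_space) :
  dual_norm (a *: f) <= `|a| * dual_norm f.
Proof.
apply: dual_norm_le => [|x]; first by rewrite mulr_ge0 ?dual_norm_ge0.
by rewrite (_ : (a *: f) x = a *: f x)// normrZ -mulrA ler_wpM2l// dual_normP.
Qed.

Let dual_norm_eq0 (f : dual_space) : dual_norm f = 0 -> f = 0.
Proof.
move=> f0; apply: val_inj; apply/funext => x /=.
apply/eqP; rewrite -normr_le0.
by apply: le_trans (dual_normP f x) _; rewrite f0 mul0r.
Qed.

Let dual_normZ (a : R[i]) (f : dual_space) :
  dual_norm (a *: f) = `|a| * dual_norm f.
Proof.
apply/eqP; rewrite eq_le dual_normZle /=.
have [->|a0] := eqVneq a 0; first by rewrite normr0 mul0r dual_norm_ge0.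
rewrite -ler_pdivlMl ?normr_gt0// -normfV.
by apply: le_trans (dual_normZle _ _); rewrite scalerA mulVf// scale1r.
Qed.

HB.instance Definition _ := Lmodule_isNormed.Build R[i] dual_space
  dual_normD dual_normZ dual_norm_eq0.

End Dual.

Section Orthogonality.
Context {R : realType} {X : normedModType R[i]}.
Implicit Types (T : X -> dual_space X) (theta : R) (x y : X).

Definition perp T x y : Prop := T x y = 0.

Definition left_symmetric_at T x : Prop :=
  forall y, perp T x y -> perp T y x.

Definition rotated T theta x y : R :=
  cos theta * complex.Re (T x y) + sin theta * complex.Im (T x y).

Definition plus_set T theta x : set X := [set y | 0 <= rotated T theta x y].

Definition minus_set T theta x : set X := [set y | rotated T theta x y <= 0].

End Orthogonality.

(* Main.v *)
(* Since T is linear, f = (Tx, .) and g = (T., x) are both linear functionals,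
   and left symmetry at x says ker f is contained in ker g, i.e. g = c f for a
   scalar c.  Since (T_theta x, y) = Re (exp(-i theta) f y), choosing phi0 so
   that c = |c| exp(-i phi0) gives (T_(theta - phi0) y, x) = |c| (T_theta x, y).
   Conversely, if f y = 0 then (T_(theta - phi0) y, x) is both nonnegative and
   nonpositive; theta = 0 and theta = pi / 2 suffice to get g y = 0. *)
Require Import Defs.
From HB Require Import structures.
From mathcomp Require Import all_boot all_order all_algebra.
From mathcomp Require Import all_classical all_reals all_analysis.
From mathcomp Require Import complex.
From mathcomp Require Import ring lra.

Set Implicit Arguments.
Unset Strict Implicit.
Unset Printing Implicit Defensive.

Import Order.TTheory GRing.Theory Num.Theory.
Import numFieldNormedType.Exports.

Local Open Scope classical_set_scope.
Local Open Scope complex_scope.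
Local Open Scope ring_scope.

(** Since [acos] lands in [0, pi], where sine is nonnegative, the angle [acos (a / r)] gives the
    right cosine but only [|b|] for the sine; when [b < 0] it is reflected to
    [2 * pi - acos (a / r)]. *)
Lemma polar_decomposition (R : realType) (a b : R) :
  exists r phi : R, [/\ 0 <= r, 0 <= phi < 2 * pi,
    a = r * cos phi & b = r * sin phi].
Proof.
have pi0 := pi_gt0 R.
set r := Num.sqrt (a ^+ 2 + b ^+ 2).
have r2 : r ^+ 2 = a ^+ 2 + b ^+ 2 by rewrite sqr_sqrtr// addr_ge0// sqr_ge0.
have [r0|rN0] := eqVneq r 0.
  move/eqP: r2; rewrite r0 expr0n/= eq_sym paddr_eq0 ?sqr_ge0// !sqrf_eq0.
  case/andP => /eqP-> /eqP->; exists 0, 0.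
  by rewrite !mul0r lexx mulr_gt0.
have rp : 0 < r by rewrite lt_def rN0 sqrtr_ge0.
have ar : - 1 <= a / r <= 1.
  rewrite -ler_norml -(@ler_sqr _ _ 1) ?nnegrE// real_normK ?num_real//.
  rewrite expr1n expr_div_n ler_pdivrMr ?exprn_gt0// mul1r r2.
  by rewrite lerDl sqr_ge0.
have cosE : r * cos (acos (a / r)) = a by rewrite acosK// mulrC divfK.
have sinE : r * sin (acos (a / r)) = `|b|.
  rewrite sin_acos// -[X in X * _](ger0_norm (ltW rp)) -!sqrtr_sqr.
  rewrite -sqrtrM ?sqr_ge0//; congr Num.sqrt.
  by rewrite mulrBr mulr1 -exprMn [r * _]mulrC divfK// r2 addrC addKr.
have [b0|b0] := leP 0 b.
  exists r, (acos (a / r)); rewrite cosE sinE ger0_norm// ltW//; split=> //.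
  rewrite acos_ge0//=; apply: le_lt_trans (acos_lepi ar) _.
  by rewrite ltr_pMl// ltr1n.
exists r, (2 * pi - acos (a / r)).
have cos2 z : cos (2 * pi - z) = cos z :> R.
  by rewrite mulr_natl cosB cos2pi sin2pi mul1r mul0r addr0.
have sin2 z : sin (2 * pi - z) = - sin z :> R.
  by rewrite mulr_natl sinB cos2pi sin2pi mul1r mul0r sub0r.
rewrite cos2 sin2 mulrN cosE sinE ltr0_norm// opprK ltW//; split=> //.
rewrite subr_ge0 ltrBlDr ltrDl; apply/andP; split.
  by apply: le_trans (acos_lepi ar) _; rewrite ler_pMl// ler1n.
(* The reflected angle stays below [2 * pi]: [acos (a / r) = 0] would force [|b| = 0], against
   [b < 0]. *)
rewrite lt_def acos_ge0// andbT; apply/eqP => acos0.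
by move: sinE; rewrite acos0 sin0 mulr0 ltr0_norm// => /eqP; lra.
Qed.

(** If [f z] is nonzero, [y - (f y / f z) *: z] lies in the kernel of [f], hence of [g], which gives
    [c = g z / f z]. If [f] vanishes everywhere, so does [g]. *)
Lemma factor_through_kernel (K : fieldType) (V : lmodType K) (f g : V -> K^o) :
  linear f -> linear g -> (forall y, f y = 0 -> g y = 0) ->
  exists c : K, forall y, g y = c * f y.
Proof.
move=> lf lg fg.
have [[z fz]|/forallNP f0] := pselect (exists z, f z != 0); last first.
  by exists 0 => y; rewrite mul0r fg//; have /negP/negPn/eqP := f0 y.
exists (g z / f z) => y.
have := fg (- (f y / f z) *: z + y).
rewrite lf lg /GRing.scale/= !mulNr divfK// addNr => /(_ erefl) /eqP.
by rewrite addrC subr_eq0 => /eqP ->; rewrite mulrC mulrA mulrAC.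
Qed.

Theorem theorem2p10 (R : realType) (X : completeNormedModType R[i])
    (T : {linear X -> dual_space X}) (T_bounded : bounded_op T) (x : X) :
  left_symmetric_at T x <->
  exists2 phi0 : R, 0 <= phi0 < 2 * pi &
    forall theta : R, 0 <= theta < 2 * pi -> forall y : X,
      (y \in plus_set T theta x -> x \in plus_set T (theta - phi0) y) /\
      (y \in minus_set T theta x -> x \in minus_set T (theta - phi0) y).
Proof.
split=> [sym|[phi _ H] y fy0]; last first.
  have pi0 := pi_gt0 R.
  have rot0 theta : 0 <= theta < 2 * pi -> rotated T (theta - phi) y x = 0.
    move=> /H /(_ y)[]; rewrite !inE /plus_set /minus_set /= {1 3}/rotated.
    rewrite fy0 /= !mulr0 addr0 lexx => /(_ isT) p /(_ isT) m.
    by apply/eqP; rewrite eq_le m p.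
  have := rot0 0; rewrite lexx mulr_gt0// sub0r => /(_ isT).
  have := rot0 (pi / 2); rewrite divr_ge0 ?ltW//=.
  have -> : pi / 2 < 2 * pi :> R by lra.
  move=> /(_ isT).
  rewrite /perp /rotated cosN sinN cosB sinB cos_pihalf sin_pihalf.
  case: (T y x) => p q /= e1 e2.
  have cs := cos2Dsin2 phi.
  (* [e1] and [e2] are the imaginary and real parts of exp(i phi) (p + i q) = 0; multiplying by
     exp(-i phi) isolates [p] and [q]. *)
  have {}e1 : sin phi * p + cos phi * q = 0 by rewrite -e1; ring.
  have {}e2 : cos phi * p - sin phi * q = 0 by rewrite -e2; ring.
  have -> : p = 0.
    transitivity (p * (cos phi ^+ 2 + sin phi ^+ 2)); first by rewrite cs mulr1.
    transitivity (cos phi * (cos phi * p - sin phi * q)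
      + sin phi * (sin phi * p + cos phi * q)); first by ring.
    by rewrite e1 e2 !mulr0 addr0.
  have -> : q = 0.
    transitivity (q * (cos phi ^+ 2 + sin phi ^+ 2)); first by rewrite cs mulr1.
    transitivity (cos phi * (sin phi * p + cos phi * q)
      - sin phi * (cos phi * p - sin phi * q)); first by ring.
    by rewrite e1 e2 !mulr0 subr0.
  by [].
have lg : linear (fun y => T y x : (R[i])^o) by move=> a u v; rewrite linearP.
have [[u v] gE] := factor_through_kernel (dual_linear (T x)) lg sym.
(* The sign of [v] is flipped because [phi] is an argument of the conjugate of c = u + i v, so that
   c = r exp(-i phi). *)
have [r [phi [r0 phi2pi uE vE]]] := polar_decomposition u (- v).
exists phi => // theta _ y.
suff rotE : rotated T (theta - phi) y x = r * rotated T theta x y.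
  rewrite !inE /plus_set /minus_set /= rotE; split=> h; first exact: mulr_ge0.
  exact: mulr_ge0_le0.
have {}vE : v = - (r * sin phi) by rewrite -vE opprK.
rewrite /rotated gE; case: (T x y) => p q; rewrite /= uE vE cosB sinB.
have cs := cos2Dsin2 phi.
(* The shift of [theta] by [- phi] contributes exp(i phi), cancelling the exp(-i phi) of c; in real
   coordinates their product is the last factor. *)
transitivity (r * (cos theta * p + sin theta * q) * (cos phi ^+ 2 + sin phi ^+ 2)).
  by ring.
by rewrite cs mulr1.
Qed.
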